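(* Let $H$ be a Hilbert space with dual space $H^*$ and suppose that the family $\Phi=\{\phi_n\}$ is a frame on $H$. Let $\mathcal{L}:H\to H^*$ be a bounded linear operator, and let $\mathcal{L}^*:H\to H^*$ be its adjoint, i.e. $\langle \mathcal{L}u,v\rangle_{H^*,H}=\langle \mathcal{L}^*v,u\rangle_{H^*,H}$ for all $u,v\in H$. Assume that $\mathcal{L}^*$ is bounded above and below: there are constants $M_b,M_c>0$ such that for all $u\in H$ $$M_c\|u\|_H\le \|\mathcal{L}^*u\|_{H^*}\le M_b\|u\|_H .$$ Then $\mathcal{L}\Phi=\{\mathcal{L}\phi_n\}$ is a frame on the Hilbert space $H^*$.
   Context: An indexed family $\{\phi_n\}$ of elements of a Hilbert space $(H,(\cdot,\cdot)_H)$ is a frame for (on) $H$ if there are constants $0<c\le C<\infty$ with $c\|v\|_H^2\le \sum_n |(v,\phi_n)_H|^2\le C\|v\|_H^2$ for all $v\in H$. The dual $H^*$ carries the dual norm $\|u^*\|_{H^*}=\sup_{u\in H,\,u\ne 0}|\langle u^*,u\rangle_{H^*,H}|/\|u\|_H$, and is a Hilbert space with the inner product transported from $H$ by the Riesz isomorphism $R:H\to H^*$, $(f,g)_{H^*}=(R^{-1}f,R^{-1}g)_H$. *)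

(* Defs.v *)
From HB Require Import structures.
From mathcomp Require Import all_boot all_order all_algebra.
From mathcomp Require Import sesquilinear complex.
From mathcomp Require Import all_classical all_reals all_analysis.
From mathcomp Require Import ring lra.

Set Implicit Arguments.
Unset Strict Implicit.
Unset Printing Implicit Defensive.
Import Order.TTheory GRing.Theory Num.Theory.
Import numFieldNormedType.Exports.
Local Open Scope classical_set_scope.
Local Open Scope ring_scope.

(* Hilbert spaces are taken over either the real or the complex field; [of_real]
   and [re] allow norms, which mathcomp-analysis values in the scalar field, to
   be read as real numbers. *)
Variant scalar_kind := RealScalars | ComplexScalars.

Definition scalars (R : realType) (k : scalar_kind) : numFieldType :=
  match k with RealScalars => R | ComplexScalars => R[i] end.

Definition sconj (R : realType) (k : scalar_kind) : scalars R k -> scalars R k :=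
  match k with RealScalars => idfun | ComplexScalars => @conjc R end.

Definition of_real (R : realType) (k : scalar_kind) : R -> scalars R k :=
  match k with RealScalars => idfun | ComplexScalars => real_complex R end.

Definition re (R : realType) (k : scalar_kind) : scalars R k -> R :=
  match k with RealScalars => idfun | ComplexScalars => @complex.Re R end.

Arguments of_real {R} k.

Section ScalarTheory.
Context {R : realType} {k : scalar_kind}.
Notation K := (scalars R k).
Notation sconj := (@sconj R k).
Notation of_real := (@of_real R k).
Notation re := (@re R k).

Fact sconj_is_zmod_morphism : zmod_morphism sconj.
Proof. by rewrite /sconj; case: k => x y //=; rewrite rmorphB. Qed.

Fact sconj_is_monoid_morphism : monoid_morphism sconj.
Proof.
rewrite /sconj; case: k => //=.
by split=> [|x y]; [rewrite rmorph1|rewrite rmorphM].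
Qed.

HB.instance Definition _ := GRing.isZmodMorphism.Build K K sconj
  sconj_is_zmod_morphism.
HB.instance Definition _ := GRing.isMonoidMorphism.Build K K sconj
  sconj_is_monoid_morphism.

Fact of_real_is_zmod_morphism : zmod_morphism of_real.
Proof. by rewrite /of_real; case: k => x y //=; rewrite rmorphB. Qed.

Fact of_real_is_monoid_morphism : monoid_morphism of_real.
Proof.
rewrite /of_real; case: k => //=.
by split=> [|x y]; [rewrite rmorph1|rewrite rmorphM].
Qed.

HB.instance Definition _ := GRing.isZmodMorphism.Build R K of_real
  of_real_is_zmod_morphism.
HB.instance Definition _ := GRing.isMonoidMorphism.Build R K of_real
  of_real_is_monoid_morphism.

Fact re_is_zmod_morphism : zmod_morphism re.
Proof. by rewrite /re; case: k => // -[a b] [c d]. Qed.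

HB.instance Definition _ := GRing.isZmodMorphism.Build K R re
  re_is_zmod_morphism.

Lemma sconjK : involutive sconj.
Proof. by rewrite /sconj; case: k => //=; exact: conjcK. Qed.

Lemma of_realK : cancel of_real re.
Proof. by rewrite /of_real /re; case: k. Qed.

Lemma reK (x : K) : x \is Num.real -> of_real (re x) = x.
Proof.
rewrite /of_real /re; case: k x => // -[a b] /=.
by rewrite realE !lecE /= => /orP[] /andP[/eqP]; [move=> -> | move=> <-].
Qed.

Lemma reK_ge0 (x : K) : 0 <= x -> of_real (re x) = x.
Proof. by move=> x0; rewrite reK// ger0_real. Qed.

Lemma reK_norm (V : normedZmodType K) (x : V) : of_real (re `|x|) = `|x|.
Proof. exact: reK_ge0. Qed.

Lemma ler_of_real : {mono of_real : x y / x <= y}.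
Proof. by rewrite /of_real; case: k => //= x y; rewrite lecR. Qed.

Lemma ltr_of_real : {mono of_real : x y / x < y}.
Proof. by rewrite /of_real; case: k => //= x y; rewrite ltcR. Qed.

Lemma of_real_ge0 (a : R) : (0 <= of_real a) = (0 <= a).
Proof. by rewrite -(ler_of_real 0) rmorph0. Qed.

Lemma of_real_gt0 (a : R) : (0 < of_real a) = (0 < a).
Proof. by rewrite -(ltr_of_real 0) rmorph0. Qed.

Lemma of_real_lt0 (a : R) : (of_real a < 0) = (a < 0).
Proof. by rewrite -(ltr_of_real a) rmorph0. Qed.

Lemma le_re (x y : K) : x <= y -> re x <= re y.
Proof. by rewrite /re; case: k x y => //= x y; rewrite lecE => /andP[]. Qed.

Lemma re_le_norm (x : K) : re x <= re `|x|.
Proof.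
rewrite /re; case: k x => /= x; first exact: ler_norm.
by case: x => a b /=; rewrite (le_trans (ler_norm _))// -sqrtr_sqr ler_wsqrtr// lerDl sqr_ge0.
Qed.

Lemma re_conj (x : K) : re (sconj x) = re x.
Proof. by rewrite /re /sconj; case: k x => //= -[]. Qed.

Lemma reZ (a : R) (x : K) : re (of_real a * x) = a * re x.
Proof. by rewrite /re /of_real; case: k x => //= -[b c] /=; rewrite mul0r subr0. Qed.

Lemma sconj_of_real (a : R) : sconj (of_real a) = of_real a.
Proof. by rewrite /sconj /of_real; case: k => //=; rewrite oppr0. Qed.

Lemma mul_sconj (x : K) : x * sconj x = `|x| ^+ 2.
Proof.
rewrite /sconj; case: k x => /= x; first by rewrite real_normK ?num_real.
case: x => a b; rewrite normc_def -rmorphXn/= sqr_sqrtr ?addr_ge0 ?sqr_ge0//.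
by apply/eqP; rewrite eq_complex/= !mulrN opprK -!expr2 [b * a]mulrC addNr !eqxx.
Qed.

Lemma norm_sconj (x : K) : `|sconj x| = `|x|.
Proof.
apply/eqP; rewrite -(@eqrXn2 _ 2)//.
by rewrite -!mul_sconj sconjK mulrC.
Qed.
End ScalarTheory.


(* `|x| as an element of R; no information is lost, see [normE]. *)
Definition rnorm (R : realType) (k : scalar_kind)
  (V : normedZmodType (scalars R k)) (x : V) : R := re `|x|.

Section RealNorm.
Context {R : realType} {k : scalar_kind}.
Notation K := (scalars R k).
Implicit Types V : normedZmodType K.

Lemma normE V (x : V) : `|x| = of_real k (rnorm x).
Proof. by rewrite /rnorm reK_norm. Qed.

Lemma rnormE V (x : V) (a : R) : `|x| = of_real k a -> rnorm x = a.
Proof. by rewrite /rnorm => ->; rewrite of_realK. Qed.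

Lemma rnorm_ge0 V (x : V) : 0 <= rnorm x.
Proof. by rewrite -(@ler_of_real R k) rmorph0 -normE. Qed.

Lemma rnorm0 V : rnorm (0 : V) = 0.
Proof. by rewrite /rnorm normr0 raddf0. Qed.

Lemma rnorm_eq0 V (x : V) : (rnorm x == 0) = (x == 0).
Proof.
apply/eqP/eqP => [x0|->]; last exact: rnorm0.
by apply/eqP; rewrite -normr_eq0 normE x0 rmorph0.
Qed.

Lemma rnorm_gt0 V (x : V) : (0 < rnorm x) = (x != 0).
Proof. by rewrite lt0r rnorm_eq0 rnorm_ge0 andbT. Qed.

Lemma rnormD V (x y : V) : rnorm (x + y) <= rnorm x + rnorm y.
Proof. by rewrite -(@ler_of_real R k) rmorphD /= -!normE ler_normD. Qed.

Lemma rnormN V (x : V) : rnorm (- x) = rnorm x.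
Proof. by rewrite /rnorm normrN. Qed.

Lemma rnormM (x y : K) : rnorm (x * y) = rnorm x * rnorm y.
Proof. by apply: rnormE; rewrite normrM !normE rmorphM. Qed.

Lemma rnormZ (V : normedModType K) (a : K) (x : V) :
  rnorm (a *: x) = rnorm a * rnorm x.
Proof. by apply: rnormE; rewrite normrZ !normE rmorphM. Qed.

Lemma rnorm_of_real (a : R) : rnorm (of_real k a) = `|a|.
Proof.
apply: rnormE; have [a0|a0] := leP 0 a.
  by rewrite !ger0_norm ?of_real_ge0.
by rewrite !ltr0_norm ?of_real_lt0// rmorphN.
Qed.

Lemma re_le_rnorm (x : K) : re x <= rnorm x. Proof. exact: re_le_norm. Qed.

Lemma rnorm_sconj (x : K) : rnorm (sconj x) = rnorm x.
Proof. by rewrite /rnorm norm_sconj. Qed.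
End RealNorm.

(* As in [{dot V for _}], the inner product is linear in its first argument and
   conjugate-linear in the second one. *)
HB.mixin Record NormedModule_isHilbert (R : realType) (k : scalar_kind) V
    of CompleteNormedModule (scalars R k) V := {
  inner : {dot V for @sconj R k};
  inner_normE : forall v, inner v v = `|v| ^+ 2
}.

#[short(type="hilbertType")]
HB.structure Definition Hilbert (R : realType) (k : scalar_kind) :=
  {V of NormedModule_isHilbert R k V & CompleteNormedModule (scalars R k) V}.


Section HilbertTheory.
Context {R : realType} {k : scalar_kind} {H : hilbertType R k}.
Notation K := (scalars R k).
Implicit Types (u v w : H) (a : K).

Lemma innerC u v : inner u v = sconj (inner v u).
Proof. by rewrite (@hermitian_subproof _ _ _ _ (@inner R k H)) expr0 mul1r. Qed.

Lemma innerBr u v w : inner u (v - w) = inner u v - inner u w.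
Proof. exact: linearBr. Qed.

Lemma innerBl u v w : inner (u - v) w = inner u w - inner v w.
Proof. exact: linearBl. Qed.

Lemma innerDr u v w : inner u (v + w) = inner u v + inner u w.
Proof. exact: linearDr. Qed.

Lemma innerDl u v w : inner (u + v) w = inner u w + inner v w.
Proof. exact: linearDl. Qed.

Lemma innerZr a u v : inner u (a *: v) = sconj a * inner u v.
Proof. exact: linearZr_LR. Qed.

Lemma innerZl a u v : inner (a *: u) v = a * inner u v.
Proof. exact: linearZl_LR. Qed.

Lemma innervv u : inner u u = of_real k (rnorm u ^+ 2).
Proof. by rewrite inner_normE normE rmorphXn. Qed.

Lemma re_innervv u : re (inner u u) = rnorm u ^+ 2.
Proof. by rewrite innervv of_realK. Qed.

Lemma re_innerC u v : re (inner u v) = re (inner v u).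
Proof. by rewrite innerC re_conj. Qed.

Lemma rnorm_sqrD u v :
  rnorm (u + v) ^+ 2 = rnorm u ^+ 2 + 2 * re (inner u v) + rnorm v ^+ 2.
Proof.
rewrite -!re_innervv innerDl !innerDr !raddfD/= (re_innerC v); ring.
Qed.

Lemma cauchy_schwarz u v : rnorm (inner u v) <= rnorm u * rnorm v.
Proof.
rewrite -(@ler_of_real R k) rmorphM /= -!normE.
have [->|v0] := eqVneq v 0; first by rewrite [inner _ _]linear0r !normr0 mulr0.
have nv0 : 0 < `|v| by rewrite normr_gt0.
rewrite -(@ler_pXn2r _ 2) ?nnegrE ?mulr_ge0//.
pose c := inner u v / `|v| ^+ 2.
have : 0 <= inner (u - c *: v) (u - c *: v) by rewrite inner_normE exprn_ge0.
rewrite innerBr innerBl innerZr innerBl !innerZl [inner v v]inner_normE.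
rewrite divfK ?expf_neq0 ?gt_eqF// subrr mulr0 subr0 inner_normE (innerC v).
by rewrite subr_ge0 /c mulrAC mul_sconj ler_pdivrMr ?exprn_gt0// exprMn.
Qed.

Lemma inner_inj u v : (forall w, inner w u = inner w v) -> u = v.
Proof.
move=> uv; apply/eqP; rewrite -subr_eq0 -normr_eq0 -sqrf_eq0 -inner_normE.
by rewrite innerBr uv subrr.
Qed.

Section Riesz.
Variables (f : H -> K) (M : R).
Hypothesis fP : forall a u v, f (a *: u + v) = a * f u + f v.
Hypothesis fM : forall u, rnorm (f u) <= M * rnorm u.

Let J u : R := rnorm u ^+ 2 - 2 * re (f u).

Let has_inf_J : has_inf (range J).
Proof.
split; first by exists (J 0), 0.
exists (- M ^+ 2) => _ [u _ <-]; rewrite /J.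
have := le_trans (re_le_rnorm (f u)) (fM u).
by have := sqr_ge0 (rnorm u - M); nra.
Qed.

Let quadratic (q d e : R) : 0 <= q ->
  (forall t : R, 0 <= t ^+ 2 * q + 2 * t * d + e) -> d ^+ 2 <= e * q.
Proof.
move=> q0 h; have [->|d0] := eqVneq d 0.
  by rewrite expr0n/= mulr_ge0//; have := h 0; lra.
move: q0; rewrite le_eqVlt => /orP[/eqP q0|q0].
  have := h (- (e + 1) / (2 * d)).
  by rewrite -q0 mulr0 add0r mulrAC mulrC divfK ?mulf_neq0//; lra.
have := h (- d / q); rewrite -(ler_pM2r q0) mul0r.
have -> : ((- d / q) ^+ 2 * q + 2 * (- d / q) * d + e) * q = e * q - d ^+ 2.
  by field; rewrite gt_eqF.
by rewrite subr_ge0.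
Qed.

Let riesz_approx (e : R) : 0 < e ->
  exists u, forall w, rnorm (inner w u - f w) <= e * rnorm w.
Proof.
move=> e0; have e20 : 0 < e ^+ 2 by rewrite exprn_gt0.
have [_ [u _ <-] Ju] := inf_adherent e20 has_inf_J.
exists u => w.
have Jinf v : inf (range J) <= J v by apply: ge_inf; [exact: has_inf_J.2|exists v].
have key v : (re (inner v u - f v)) ^+ 2 <= e ^+ 2 * rnorm v ^+ 2.
  apply: quadratic => [|t]; first exact: sqr_ge0.
  have := Jinf (of_real k t *: v + u); rewrite {2}/J fP rnorm_sqrD innerZl.
  rewrite raddfD/= !reZ rnormZ rnorm_of_real exprMn real_normK ?num_real//.
  by move: Ju; rewrite raddfB/= /J; lra.
set z := inner w u - f w; have := key (sconj z *: w).
have f0 : f 0 = 0 by have := fP (-1) 0 0; rewrite scaler0 addr0 mulN1r addNr.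
have fZ a v : f (a *: v) = a * f v by rewrite -[a *: v]addr0 fP f0 addr0.
rewrite innerZl fZ -mulrBr -/z [_ * z]mulrC mul_sconj normE -rmorphXn of_realK.
rewrite rnormZ rnorm_sconj; have [z0|z0] := eqVneq (rnorm z) 0.
  by rewrite z0 => _; rewrite mulr_ge0 ?rnorm_ge0// ltW.
have {z0} : 0 < rnorm z ^+ 2 by rewrite exprn_gt0// lt0r z0 rnorm_ge0.
move=> z20 h.
suff : rnorm z ^+ 2 <= (e * rnorm w) ^+ 2.
  by rewrite ler_pXn2r// nnegrE ?mulr_ge0 ?rnorm_ge0// ltW.
suff : rnorm z ^+ 2 * rnorm z ^+ 2 <= rnorm z ^+ 2 * (e * rnorm w) ^+ 2.
  by rewrite ler_pM2l.
by move: h; rewrite -expr2 => /le_trans; apply; rewrite !exprMn mulrCA.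
Qed.

Lemma riesz_exists : exists u, forall w, f w = inner w u.
Proof.
have n0 n : 0 < (n.+1%:R : R)^-1 by [].
pose u n := sval (cid (riesz_approx (n0 n))).
have uP n w : rnorm (inner w (u n) - f w) <= n.+1%:R^-1 * rnorm w.
  exact: (svalP (cid (riesz_approx (n0 n)))).
have uD n m : rnorm (u n - u m) <= n.+1%:R^-1 + m.+1%:R^-1.
  have [->|un0] := eqVneq (u n - u m) 0.
    by rewrite rnorm0 addr_ge0// ltW.
  rewrite -(@ler_pM2r _ (rnorm (u n - u m))) ?rnorm_gt0// -expr2 -re_innervv.
  rewrite (le_trans (re_le_rnorm _))// mulrDl innerBr.
  apply: le_trans (lerD (uP n _) (uP m _)); set d := u n - u m.
  rewrite -[X in _ <= _ + X]rnormN; apply: le_trans (rnormD _ _).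
  by rewrite opprB addrA subrK.
have n_lt (e : K) : 0 < e -> \forall n \near \oo, of_real k n.+1%:R^-1 < e / 2.
  move=> e0; rewrite -[e / 2]reK_ge0; last by rewrite ltW// divr_gt0.
  have e20 : 0 < re (e / 2).
    by rewrite -(@of_real_gt0 R k) reK_ge0 ?divr_gt0// ltW// divr_gt0.
  near=> n; rewrite ltr_of_real; near: n.
  exact: near_infty_natSinv_lt (PosNum e20).
have : cvg (u @ \oo).
  apply: cauchy_cvg; apply/cauchy_exP => e e0.
  near \oo => n.
  exists (u n); rewrite nbhs_simpl/=; near=> m.
  rewrite -ball_normE /= normE (le_lt_trans (y := of_real k (n.+1%:R^-1 + m.+1%:R^-1)))//.
    by rewrite ler_of_real.
  by rewrite rmorphD/= [e]splitr ltrD//; [near: n|near: m]; exact: (n_lt _).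
move=> /cvg_ex[v /cvgrPdist_lt uv]; exists v => w.
apply/eqP; rewrite eq_sym -subr_eq0 -rnorm_eq0 eq_le rnorm_ge0 andbT.
apply/ler_addgt0Pr => e e0; rewrite add0r.
pose c := 1 + rnorm w; have c0 : 0 < c by rewrite ltr_pwDl ?rnorm_ge0.
have ec0 : 0 < of_real k (e / c) by rewrite of_real_gt0 divr_gt0.
have ec20 : 0 < of_real k (e / c) / 2 by apply: divr_gt0.
near \oo => n.
have h1 : rnorm (v - u n) <= e / c / 2.
  rewrite -(@ler_of_real R k) -normE rmorphM fmorphV rmorph_nat/=.
  by apply/ltW; near: n; apply: uv.
have h2 : n.+1%:R^-1 <= e / c / 2.
  rewrite -(@ler_of_real R k) rmorphM [in leRHS]fmorphV rmorph_nat/=.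
  by apply/ltW; near: n; exact: (n_lt _).
have -> : inner w v - f w = inner w (v - u n) + (inner w (u n) - f w).
  by rewrite innerBr addrA subrK.
rewrite (le_trans (rnormD _ _))// (le_trans (lerD (cauchy_schwarz _ _) (uP n w)))//.
rewrite [rnorm w * _]mulrC -mulrDl.
have -> : e = (e / c / 2 + e / c / 2) * c by rewrite -splitr divfK ?gt_eqF.
apply: ler_pM; [by rewrite addr_ge0 ?rnorm_ge0|exact: rnorm_ge0|exact: lerD|].
by rewrite /c lerDr.
Unshelve. all: by end_near. Qed.

End Riesz.
End HilbertTheory.

Section Dual.
Context {R : realType} {k : scalar_kind} (H : hilbertType R k).
Notation K := (scalars R k).

Definition continuous_linear : {pred H -> K^o} :=
  [pred f | `[< linear f /\ continuous f >]].

Fact continuous_linear_submod_closed : submod_closed continuous_linear.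
Proof.
split.
  apply/asboolP; split; first by move=> a u v; rewrite -[RHS]/(a *: (0 : K^o) + 0) scaler0 addr0.
  by move=> u; exact: cvg_cst.
move=> a f g /asboolP[fl fc] /asboolP[gl gc]; apply/asboolP; split.
  move=> b u v /=; rewrite -[LHS]/(a *: f _ + g _) -[RHS]/(b *: (a *: f u + g u) + (a *: f v + g v)) fl gl !scalerDr !scalerA [a * b]mulrC.
  by rewrite -!addrA; congr (_ + _); rewrite addrCA.
by move=> u; apply: cvgD; [apply: cvgZl_tmp; exact: fc|exact: gc].
Qed.

HB.instance Definition _ :=
  GRing.isSubmodClosed.Build K (H -> K^o) continuous_linear
    continuous_linear_submod_closed.

(* Continuous linear functionals; [f u] is the duality pairing <f, u>. *)
Record dual : Type := Dual {
  dual_fun :> H -> K^o;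
  _ : dual_fun \in continuous_linear
}.

HB.instance Definition _ := [isSub for dual_fun].
HB.instance Definition _ := [Choice of dual by <:].
HB.instance Definition _ := [SubChoice_isSubLmodule of dual by <:].

Implicit Types (f g : dual) (u v w : H) (a : K).

Lemma dualP f a u v : f (a *: u + v) = a * f u + f v.
Proof. by have /asboolP[fl _] := valP f; exact: fl. Qed.

Lemma dualE f g a u : (a *: f + g) u = a * f u + g u.
Proof. by []. Qed.

Lemma dualext f g : f =1 g -> f = g.
Proof. by move=> fg; apply/val_inj/funext. Qed.

Lemma dual_bounded f : exists M : R, forall u, rnorm (f u : K) <= M * rnorm u.
Proof.
have /asboolP[fl fc] := valP f.
pose fL := GRing.isLinear.Build _ _ _ _ _ fl.
pose F : {linear H -> K^o} := HB.pack (f : H -> K^o) fL.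
have /linear_boundedP : bounded_near F (nbhs 0).
  exact/linear_bounded_continuous/fc.
move=> [M [Mreal FM]]; exists (re M + 1) => u.
rewrite -(@ler_of_real R k) rmorphM rmorphD rmorph1 /= -!normE.
by apply: FM; rewrite (reK Mreal) ltrDl.
Qed.

Lemma rieszP f : exists v, forall u, f u = inner u v.
Proof.
have [M fM] := dual_bounded f.
exact: (riesz_exists (dualP f) fM).
Qed.

Definition riesz_inv f : H := get [set v | forall u, f u = inner u v].

Lemma riesz_invP f u : f u = inner u (riesz_inv f).
Proof. by have /(getPex (P := [set v | forall u, f u = inner u v])) := rieszP f. Qed.

Lemma riesz_inv_unique f v : (forall u, f u = inner u v) -> riesz_inv f = v.
Proof. by move=> fv; apply: inner_inj => w; rewrite -riesz_invP fv. Qed.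

Fact inner_continuous_linear v : (inner^~ v : H -> K^o) \in continuous_linear.
Proof.
have il : linear (inner^~ v : H -> K^o).
  by move=> a x y; rewrite innerDl innerZl.
apply/asboolP; split=> //.
pose fL := GRing.isLinear.Build _ _ _ _ _ il.
pose F : {linear H -> K^o} := HB.pack (inner^~ v : H -> K^o) fL.
apply: (@bounded_linear_continuous K H K^o F); apply/linear_boundedP.
exists `|v|; split=> // r vr x; have := cauchy_schwarz x v.
rewrite -(@ler_of_real R k) rmorphM /= -!normE => /le_trans; apply.
by rewrite mulrC ler_wpM2r// ltW.
Qed.

Definition riesz v : dual := Dual (inner_continuous_linear v).

Lemma rieszK : cancel riesz riesz_inv.
Proof. by move=> v; apply: riesz_inv_unique. Qed.

Lemma riesz_invK : cancel riesz_inv riesz.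
Proof. by move=> f; apply: dualext => u; rewrite /= -riesz_invP. Qed.

Lemma riesz_invD f g : riesz_inv (f + g) = riesz_inv f + riesz_inv g.
Proof.
by apply: riesz_inv_unique => u; rewrite innerDr -!riesz_invP.
Qed.

Lemma riesz_invZ a f : riesz_inv (a *: f) = sconj a *: riesz_inv f.
Proof.
by apply: riesz_inv_unique => u; rewrite innerZr sconjK -!riesz_invP.
Qed.

Lemma riesz_inv0 : riesz_inv 0 = 0.
Proof. by apply: riesz_inv_unique => u; rewrite [RHS]linear0r. Qed.

Lemma riesz_invB f g : riesz_inv (f - g) = riesz_inv f - riesz_inv g.
Proof.
by rewrite riesz_invD -[- g]scaleN1r riesz_invZ rmorphN1 scaleN1r.
Qed.

(* When H = {0} the set is empty and [sup] is 0, as it should be. *)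
Definition dual_norm f : R :=
  sup [set rnorm (f u : K) / rnorm u | u in [set u : H | u != 0]].

Lemma dual_normE f : dual_norm f = rnorm (riesz_inv f).
Proof.
set v := riesz_inv f; rewrite /dual_norm; set A := image _ _.
have Aub : ubound A (rnorm v).
  move=> _ [u u0 <-]; rewrite ler_pdivrMr ?rnorm_gt0// riesz_invP mulrC.
  exact: cauchy_schwarz.
have [v0|v0] := eqVneq v 0.
  have [A0|/set0P[x Ax]] := eqVneq A set0; first by rewrite A0 sup0 v0 rnorm0.
  apply/eqP; rewrite eq_le ge_sup//=; last by exists x.
  rewrite v0 rnorm0 (@le_trans _ _ x)//; last by apply: ub_le_sup => //; exists (rnorm v).
  by case: Ax => u _ <-; rewrite divr_ge0 ?rnorm_ge0.
have Av : A (rnorm v).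
  exists v => //; rewrite riesz_invP -/v innervv rnorm_of_real ger0_norm ?sqr_ge0//.
  by rewrite expr2 mulfK// rnorm_eq0.
apply/eqP; rewrite eq_le ge_sup//=; last by exists (rnorm v).
by apply: ub_le_sup => //; exists (rnorm v).
Qed.

Fact dual_normD f g :
  of_real k (dual_norm (f + g)) <= of_real k (dual_norm f) + of_real k (dual_norm g).
Proof. by rewrite -rmorphD ler_of_real !dual_normE riesz_invD rnormD. Qed.

Fact dual_normZ a f :
  of_real k (dual_norm (a *: f)) = `|a| * of_real k (dual_norm f).
Proof.
by rewrite !dual_normE riesz_invZ rnormZ rnorm_sconj normE rmorphM.
Qed.

Fact dual_norm_eq0 f : of_real k (dual_norm f) = 0 -> f = 0.
Proof.
move=> f0; apply: (can_inj riesz_invK); rewrite riesz_inv0; apply/eqP.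
rewrite -rnorm_eq0 -dual_normE; apply/eqP/(can_inj (@of_realK R k)).
by rewrite f0 rmorph0.
Qed.

HB.instance Definition _ :=
  Lmodule_isNormed.Build K dual dual_normD dual_normZ dual_norm_eq0.

Lemma rnorm_dual f : rnorm f = dual_norm f.
Proof. exact: of_realK. Qed.

Lemma riesz_inv_norm f : `|riesz_inv f| = `|f|.
Proof. by rewrite !normE rnorm_dual dual_normE. Qed.

Fact dual_complete (F : set_system dual) : ProperFilter F -> cauchy F -> cvg F.
Proof.
move=> FF /cauchyP Fc.
have : cvg (riesz_inv @ F).
  apply: cauchy_cvg; apply/cauchy_exP => e /Fc[g Fg].
  exists (riesz_inv g); rewrite nbhs_simpl/=; apply: filterS Fg => f.
  by rewrite -!ball_normE/= -riesz_invB riesz_inv_norm.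
move=> /cvg_ex[v /cvgrPdist_lt Fv]; apply/cvg_ex; exists (riesz v).
apply/cvgrPdist_lt => e e0; apply: filterS (Fv e e0) => f /=.
by rewrite -{1}[v]rieszK -riesz_invB riesz_inv_norm.
Qed.

HB.instance Definition _ := Uniform_isComplete.Build dual dual_complete.

(* The inner product of H transported by the Riesz map. Over the complex field
   that map is conjugate-linear, hence the swap, which makes the form linear in
   its first argument; over the real field it is immaterial, see
   [dual_inner_real]. *)
Definition dual_inner f g : K := inner (riesz_inv g) (riesz_inv f).

Fact dual_inner_Dl g : zmod_morphism (dual_inner^~ g).
Proof. by move=> f1 f2; rewrite /dual_inner riesz_invB innerBr. Qed.

Fact dual_inner_Dr f : zmod_morphism (dual_inner f).
Proof. by move=> g1 g2; rewrite /dual_inner riesz_invB innerBl. Qed.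

Fact dual_inner_Zl g : scalable_for *%R (dual_inner^~ g).
Proof. by move=> a f; rewrite /dual_inner riesz_invZ innerZr sconjK. Qed.

Fact dual_inner_Zr f : scalable_for (@sconj R k \; *%R) (dual_inner f).
Proof. by move=> a g; rewrite /dual_inner riesz_invZ innerZl. Qed.

HB.instance Definition _ := @isBilinear.Build K dual dual K *%R
  (@sconj R k \; *%R) dual_inner
  dual_inner_Dl dual_inner_Dr dual_inner_Zl dual_inner_Zr.

Fact dual_inner_herm f g : dual_inner f g = (-1) ^+ false * sconj (dual_inner g f).
Proof. by rewrite expr0 mul1r /dual_inner innerC. Qed.

HB.instance Definition _ := @isHermitianSesquilinear.Build K dual false
  (@sconj R k) dual_inner dual_inner_herm.

Fact dual_inner_normE f : dual_inner f f = `|f| ^+ 2.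
Proof. by rewrite /dual_inner inner_normE riesz_inv_norm. Qed.

Fact dual_inner_gt0 f : f != 0 -> 0 < dual_inner f f.
Proof. by move=> f0; rewrite dual_inner_normE exprn_gt0// normr_gt0. Qed.

HB.instance Definition _ :=
  @isDotProduct.Build K dual dual_inner dual_inner_gt0.

HB.instance Definition _ :=
  @NormedModule_isHilbert.Build R k dual dual_inner dual_inner_normE.
End Dual.

Lemma dual_inner_real (R : realType) (H : hilbertType R RealScalars)
    (f g : dual H) : inner f g = inner (riesz_inv f) (riesz_inv g).
Proof. exact: innerC (riesz_inv g) (riesz_inv f). Qed.

(* The index set is arbitrary; [\esum] is the supremum in [0, +oo] of the
   finite partial sums. *)
Definition frame (R : realType) (k : scalar_kind) (H : hilbertType R k)
    (I : choiceType) (phi : I -> H) : Prop :=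
  exists c C : R, [/\ 0 < c, c <= C & forall v : H,
    ((c * rnorm v ^+ 2)%R%:E
       <= \esum_(n in [set: I]) (rnorm (inner v (phi n)) ^+ 2)%R%:E
       <= (C * rnorm v ^+ 2)%R%:E)%E].

(* Main.v *)
(* The coefficients of f in H^* against L phi are those of w = R^-1 (L^* (R^-1 f))
   against phi, and |w| = |L^* (R^-1 f)| is comparable to |R^-1 f| = |f|. *)

Require Import Defs.
From HB Require Import structures.
From mathcomp Require Import all_boot all_order all_algebra.
From mathcomp Require Import all_classical all_reals all_analysis.
Import Order.TTheory GRing.Theory Num.Theory.
Import numFieldNormedType.Exports.
Local Open Scope ring_scope.

(** Moving [L] across the pairing turns the frame sum of [f] against [L (phi n)] into one of [phi]
    itself. [riesz_inv] is isometric, so the two-sided bound on [Ladj] multiplies the frame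
    constants [c] and [C] by [Mc ^+ 2] and [Mb ^+ 2]. *)

(* For [v] the Riesz representative of [f], (f, L u) in H^* and
   (R^-1 (L^* v), u) in H are both the conjugate of <L u, v> = <L^* v, u>. *)
Lemma inner_dual_adjoint (R : realType) (k : scalar_kind) (H : hilbertType R k)
    (L Ladj : H -> dual H) (f : dual H) (u : H) :
  (forall u v : H, (L u) v = (Ladj v) u) ->
  inner f (L u) = inner (riesz_inv (Ladj (riesz_inv f))) u.
Proof.
move=> LE; rewrite -[LHS]/(inner (riesz_inv (L u)) (riesz_inv f)).
by rewrite innerC -riesz_invP LE riesz_invP -innerC.
Qed.

Theorem theorem5p1 (R : realType) (k : scalar_kind) (H : hilbertType R k)
    (I : choiceType) (phi : I -> H)
    (L Ladj : {linear H -> dual H}) :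
  frame phi ->
  (exists M : R, forall u : H, rnorm (L u) <= M * rnorm u) ->
  (forall u v : H, (L u) v = (Ladj v) u) ->
  (exists Mb Mc : R, [/\ 0 < Mb, 0 < Mc & forall u : H,
     Mc * rnorm u <= rnorm (Ladj u) <= Mb * rnorm u]) ->
  frame (fun n => L (phi n)).
Proof.
move=> [c [C [c0 cC phiP]]] _ LE [Mb [Mc [Mb0 Mc0 LadjP]]].
(* [Mc <= Mb] may fail when H = {0}, hence the extra summand in the upper bound. *)
exists (c * Mc ^+ 2), (C * Mb ^+ 2 + c * Mc ^+ 2); split.
- by rewrite mulr_gt0// exprn_gt0.
- by rewrite lerDr mulr_ge0 ?sqr_ge0// (le_trans (ltW c0)).
move=> f; set v := riesz_inv f.
have vE : rnorm v = rnorm f by rewrite /rnorm riesz_inv_norm.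
have wE : rnorm (riesz_inv (Ladj v)) = rnorm (Ladj v).
  by rewrite /rnorm riesz_inv_norm.
under eq_esum => n _ do rewrite (inner_dual_adjoint _ _ _ _ _ f _ LE).
have /andP[lo hi] := phiP (riesz_inv (Ladj v)).
have /andP[Llo Lhi] := LadjP v.
apply/andP; split.
  apply: le_trans lo; rewrite lee_fin wE -vE -mulrA -exprMn.
  rewrite ler_wpM2l ?(ltW c0)// ler_pXn2r// nnegrE ?rnorm_ge0//.
  by rewrite mulr_ge0 ?rnorm_ge0// ltW.
apply: (le_trans hi); rewrite lee_fin wE -vE mulrDl -mulrA -exprMn.
(* [Mb] controls the sum by the first summand alone; the second, being nonnegative, only weakens the
   bound. *)
rewrite (@le_trans _ _ (C * (Mb * rnorm v) ^+ 2))//.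
  rewrite ler_wpM2l ?(le_trans (ltW c0))// ler_pXn2r// nnegrE ?rnorm_ge0//.
  by rewrite mulr_ge0 ?rnorm_ge0// ltW.
by rewrite lerDl mulr_ge0 ?sqr_ge0// mulr_ge0 ?sqr_ge0// ltW.
Qed.
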